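(* Let $A,B$ be topped PCMs and $\alpha,\beta:A\to B$ morphisms with separating relations $\perp_\alpha,\perp_\beta$. Then the kernel $\ker\alpha$ and the equalizer $\mathrm{eql}\,\alpha\,\beta$, defined as the following relations on $A$, are separating relations on $A$: $$x\,(\ker\alpha)\,y:\Leftrightarrow x\perp_\alpha y\wedge\alpha(x)=\alpha(y)=\mathbb{1}_B,$$ $$x\,(\mathrm{eql}\,\alpha\,\beta)\,y:\Leftrightarrow x\perp_\alpha y\wedge x\perp_\beta y\wedge\alpha(x)=\beta(x)\wedge\alpha(y)=\beta(y).$$
   Context: A topped PCM is a tuple $(A,\bullet,\mathbb{1},\top,D)$ where $\bullet$ is a total commutative associative binary operation on $A$ with unit $\mathbb{1}$, $\top\in A$, and $D\subseteq A$ (the defined elements) satisfy: $\top\notin D$; $\mathbb{1}\in D$; if $x\bullet y\in D$ then $x,y\in D$; $x\bullet\top=\top\bullet x=\top$. Write $x\perp y$ for $x\bullet y\in D$. A relation $R$ on $A$ is a separating relation if: (1) $x\,R\,y$ implies $x\,R\,\mathbb{1}$; (2) $x\,R\,y$ implies $x\perp y$; (3) $\mathbb{1}\,R\,\mathbb{1}$; (4) $x\,R\,y$ iff $y\,R\,x$; (5) $x\,R\,y$ and $(x\bullet y)\,R\,z$ imply $x\,R\,(y\bullet z)$ and $y\,R\,z$. A morphism $\phi:A\to B$ of topped PCMs with separating relation $\perp_\phi$ on $A$ is a function such that $\phi(\mathbb{1}_A)=\mathbb{1}_B$, $\phi(\top_A)=\top_B$, and $x\perp_\phi y$ implies $\phi(x)\perp\phi(y)$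 and $\phi(x\bullet y)=\phi(x)\bullet\phi(y)$. *)

(* Defs.v *)
From mathcomp Require Import all_boot.

Set Implicit Arguments.
Unset Strict Implicit.
Unset Printing Implicit Defensive.

(* [pdef] is the subset D of defined elements; it is not assumed decidable. *)
Record toppedPCM := ToppedPCM {
  psort :> Type;
  pop : psort -> psort -> psort;
  punit : psort;
  ptop : psort;
  pdef : psort -> Prop;
  popC : commutative pop;
  popA : associative pop;
  pop1x : left_id punit pop;
  popx1 : right_id punit pop;
  pdef_top : ~ pdef ptop;
  pdef_unit : pdef punit;
  pdef_op : forall x y, pdef (pop x y) -> pdef x /\ pdef y;
  poptx : left_zero ptop pop;
  popxt : right_zero ptop pop
}.

Arguments punit {_}.
Arguments ptop {_}.

Declare Scope pcm_scope.
Delimit Scope pcm_scope with pcm.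
Notation "x • y" := (pop x y) (at level 40, left associativity) : pcm_scope.
Notation "𝟙" := punit (at level 0) : pcm_scope.
Notation "⊤" := ptop (at level 0) : pcm_scope.
Notation "x ⊥ y" := (pdef (pop x y)) (at level 70, no associativity) : pcm_scope.
Local Open Scope pcm_scope.

Record separating (A : toppedPCM) (R : A -> A -> Prop) : Prop := Separating {
  sep_unitr : forall x y, R x y -> R x 𝟙;
  sep_perp : forall x y, R x y -> x ⊥ y;
  sep_unit : R 𝟙 𝟙;
  sep_sym : forall x y, R x y <-> R y x;
  sep_assoc : forall x y z,
    R x y -> R (x • y) z -> R x (y • z) /\ R y z
}.

(* A morphism carries its separating relation as part of its data. *)
Record morphism (A B : toppedPCM) := Morphism {
  mfun :> A -> B;
  msep : A -> A -> Prop;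
  msep_separating : separating msep;
  mfun_unit : mfun 𝟙 = 𝟙;
  mfun_top : mfun ⊤ = ⊤;
  mfun_op : forall x y, msep x y ->
    mfun x ⊥ mfun y /\ mfun (x • y) = mfun x • mfun y
}.

Definition ker (A B : toppedPCM) (alpha : morphism A B) (x y : A) : Prop :=
  msep alpha x y /\ alpha x = 𝟙 /\ alpha y = 𝟙.

Definition eql (A B : toppedPCM) (alpha beta : morphism A B) (x y : A) : Prop :=
  msep alpha x y /\ msep beta x y /\ alpha x = beta x /\ alpha y = beta y.

(* Main.v *)
Require Import Defs.
From mathcomp Require Import ssreflect.

(** Each relation restricts separating relations by a condition on values of the morphisms. The
    separation parts inherit every axiom, and the value conditions hold at [𝟙] because morphisms
    preserve units. The substance lies in [sep_assoc], where the condition must pass to [y • z]: the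
    axiom for the underlying relation first separates [y] from [z], so the morphism is
    multiplicative there. *)

Lemma ker_separating (A B : toppedPCM) (alpha : morphism A B) :
  separating (ker alpha).
Proof.
have sepa := msep_separating alpha.
split.
- move=> x y [xy [ax _]].
  by split; [exact: sep_unitr xy | rewrite mfun_unit].
- by move=> x y [xy _]; exact: sep_perp xy.
- by split; [exact: sep_unit | rewrite mfun_unit].
- by move=> x y; split=> -[xy [ax ay]]; split=> //; apply/(sep_sym sepa).
- move=> x y z [xy [ax ay]] [xyz [_ az]].
  have [x_yz yz] := sep_assoc sepa xy xyz.
  (* Hence [alpha (y • z) = 𝟙 • 𝟙 = 𝟙]. *)
  have [_ ayz] := mfun_op yz.
  by split; split=> //; rewrite ayz ay az pop1x.
Qed.

Lemma eql_separating (A B : toppedPCM) (alpha beta : morphism A B) :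
  separating (eql alpha beta).
Proof.
have sepa := msep_separating alpha.
have sepb := msep_separating beta.
split.
- move=> x y [xya [xyb [abx _]]].
  split; first exact: sep_unitr xya.
  by split; [exact: sep_unitr xyb | rewrite !mfun_unit].
- by move=> x y [xya _]; exact: sep_perp xya.
- split; first exact: sep_unit.
  by split; [exact: sep_unit | rewrite !mfun_unit].
- have sym x y : eql alpha beta x y -> eql alpha beta y x.
    move=> [xya [xyb [abx aby]]].
    by split; [apply/(sep_sym sepa) | split; first apply/(sep_sym sepb)].
  by move=> x y; split; exact: sym.
- move=> x y z [xya [xyb [abx aby]]] [xyza [xyzb [_ abz]]].
  have [x_yza yza] := sep_assoc sepa xya xyza.
  have [x_yzb yzb] := sep_assoc sepb xyb xyzb.
  (* Separation of [y] and [z] under both relations lets both maps split: [alpha (y • z) = alpha y •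
     alpha z = beta y • beta z = beta (y • z)]. *)
  have [_ ayz] := mfun_op yza.
  have [_ byz] := mfun_op yzb.
  by split; do 2![split=> //]; rewrite ayz byz aby abz.
Qed.

Theorem mainTheorem3 (A B : toppedPCM) (alpha beta : morphism A B) :
  separating (ker alpha) /\ separating (eql alpha beta).
Proof. by split; [exact: ker_separating | exact: eql_separating]. Qed.
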